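(* Let $\mathcal U$ be a unification algorithm satisfying renaming compatibility (for every renaming $\rho$ and every unifiable equation $E$, $\mathcal U(\rho(E))=\rho(\mathcal U(E))$) and yielding relevant mgus. Let $$G \xrightarrow{\mathcal K_1:\sigma_1} G_1 \xrightarrow{\mathcal K_2:\sigma_2}\cdots\xrightarrow{\mathcal K_n:\sigma_n} G_n,\qquad G' \xrightarrow{\mathcal K'_1:\sigma'_1} G'_1 \xrightarrow{\mathcal K'_2:\sigma'_2}\cdots\xrightarrow{\mathcal K'_n:\sigma'_n} G'_n$$ be two similar SLD-derivations (computed with $\mathcal U$). Then finite similar SLD-derivations starting from variant queries have variant partial answers, and the variance depends only on the starting queries and the input clauses. Precisely: put $\alpha:=\mathrm{pren}(G,G')$, $\lambda_i:=\mathrm{pren}(\mathcal K_i,\mathcal K'_i)$ and $\beta_i:=\alpha\oplus\lambda_1\oplus\cdots\oplus\lambda_i$. Then for every $i=1,\dots,n$: $$G'_i=\beta_i(G_i),\qquad \sigma'_i=\beta_i(\sigma_i),\qquad \sigma'_i\circ\cdots\circ\sigma'_1=\beta_i(\sigma_i\circ\cdots\circ\sigma_1).$$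
   Context: Terms are built from a countably infinite set $V$ of variables and function symbols; $\mathrm{vars}(t)$ is the set of variables of $t$. A substitution is a map $\theta$ from variables to terms with finite active domain $\mathrm{Dom}(\theta)=\{x:\theta(x)\neq x\}$, extended homomorphically to terms; $(\theta\circ\sigma)(x)=\theta(\sigma(x))$; $\mathrm{vars}(\theta)=\mathrm{Dom}(\theta)\cup\mathrm{vars}(\theta(\mathrm{Dom}(\theta)))$. A renaming is a bijective substitution mapping variables to variables. Relaxed core: a substitution may be given together with a fixed finite set $C^+(\theta)\supseteq\mathrm{Dom}(\theta)$ (its relaxed core, possibly containing passive variables $x$ with $\theta(x)=x$); $R^+(\theta)=\theta(C^+(\theta))$. A prenaming is a substitution $\alpha$ mapping variables to variables, together with a finite relaxed core $C^+(\alpha)\supseteq\mathrm{Dom}(\alpha)$ on which $\alpha$ is injective. If $\alpha,\beta$ are prenamings with $C^+(\alpha)\cap C^+(\beta)=\emptyset$ and $R^+(\alpha)\cap R^+(\beta)=\emptyset$, their sum $\alpha\oplus\beta$ is the prenaming with relaxed core $C^+(\alpha)\cup C^+(\beta)$ that agrees with $\alpha$ on $C^+(\alpha)$, with $\beta$ on $C^+(\beta)$, and is the identity elsewhere. For terms $s,t$ such that $t$ is obtained from $s$ by an injective replacement of variables by variables, $\mathrm{pren}(s,t)$ is the unique prenaming $\alpha$ with $C^+(\alpha)=\mathrm{vars}(s)$ and $\alpha(s)=t$ (so $R^+(\alpha)=\mathrm{vars}(t)$). $\mathrm{noninj}(\alpha)=R^+(\alpha)\setminus C^+(\alpha)$,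 $\mathrm{indom}(\alpha)=V\setminus\mathrm{noninj}(\alpha)$; $\alpha$ is safe for a term (or substitution) $t$ if $\mathrm{vars}(t)\subseteq\mathrm{indom}(\alpha)$; $s$ and $t$ are variants if $s=\alpha(t)$ for a prenaming $\alpha$ safe for $t$. For a substitution $\sigma$ and a prenaming $\alpha$ safe for $\sigma$, the substitution variant is $\alpha(\sigma):=\{\alpha(x)/\alpha(\sigma(x)) : x\in\mathrm{Dom}(\sigma)\}$ (the substitution mapping each $\alpha(x)$, $x\in\mathrm{Dom}(\sigma)$, to $\alpha(\sigma(x))$ and identity elsewhere). SLD-derivations: a goal is a sequence of atoms. An SLD step $G\xrightarrow{\mathcal K:\sigma}H$ with $G=(M,A,N)$ selects atom $A$, uses an input clause $\mathcal K= A_1\leftarrow B_1$ which is a variant of a program clause whose variables are disjoint from all variables of the derivation so far (standardization apart), $\sigma=\mathcal U(A,A_1)$ is the mgu computed by the fixed algorithm $\mathcal U$, and $H=\sigma(M,B_1,N)$. An mgu $\sigma$ of $A,A_1$ is relevant if $\mathrm{vars}(\sigma)\subseteq\mathrm{vars}(A)\cup\mathrm{vars}(A_1)$. The partial answer at step $i$ is $\sigma_i\circ\cdots\circ\sigma_1$. Two SLD-derivations of the same length are similar if their initial goals $G,G'$ are variants and at each step atoms in the same position are selected and the input clauses $\mathcal K_i,\mathcal K'_i$ are variants. *)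

(* Defs.v *)
From HB Require Import structures.
From mathcomp Require Import all_boot finmap boolp.

Set Implicit Arguments.
Unset Strict Implicit.
Unset Printing Implicit Defensive.

Local Open Scope fset_scope.

Record signature := Signature {
  fsym : Type;
  farity : fsym -> nat;
  psym : Type;
  parity : psym -> nat }.

Section Syntax.
Variables (V : countType) (S : signature).

Inductive term :=
  | Var of V
  | App (f : fsym S) of {ffun 'I_(farity f) -> term}.

HB.instance Definition _ := gen_eqMixin term.

(* The generated induction principle has no hypothesis for the arguments. *)
Lemma term_induction (P : term -> Prop) :
  (forall x, P (Var x)) ->
  (forall f (a : {ffun 'I_(farity f) -> term}),
     (forall i, P (a i)) -> P (App a)) ->
  forall t, P t.
Proof.
move=> PV PA; fix IH 1 => -[x|f a]; first exact: PV.
by apply: PA => i; apply: IH.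
Qed.

(* Since the default value at x is Var x, finsupp s is the active domain
   {x | s x <> x}. *)
Definition subst := {fsfun V -> term for Var}.

Fixpoint term_vars (t : term) : {fset V} :=
  match t with
  | Var x => [fset x]
  | App f a => \bigcup_(i in 'I_(farity f)) term_vars (a i)
  end.

Fixpoint term_app (s : subst) (t : term) : term :=
  match t with
  | Var x => s x
  | App f a => App [ffun i => term_app s (a i)]
  end.

Record atom := Atom {
  atom_sym : psym S;
  atom_args : {ffun 'I_(parity atom_sym) -> term} }.

Definition goal := seq atom.
(* head and body *)
Definition clause := (atom * goal)%type.
Definition equation := (atom * atom)%type.

Definition atom_vars (A : atom) : {fset V} :=
  \bigcup_(i in 'I_(parity (atom_sym A))) term_vars (atom_args A i).
Definition atom_app (s : subst) (A : atom) : atom :=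
  Atom [ffun i => term_app s (atom_args A i)].

Lemma term_app_agree s s' t :
  term_app s t = term_app s' t -> {in term_vars t, s =1 s'}.
Proof.
elim/term_induction: t => [y|f a IH] /=.
  by move=> E x; rewrite inE => /eqP ->.
move=> E x /bigfcupP[i _ xi]; apply: (IH i) xi.
pose arg u j := if u is App g b then
  (if insub j is Some k then b k else u) else u.
have /(congr1 (fun u => arg u i)) := E.
by rewrite /arg /= valK !ffunE.
Qed.

Lemma atom_app_agree s s' A :
  atom_app s A = atom_app s' A -> {in atom_vars A, s =1 s'}.
Proof.
case: A => p a E x /bigfcupP[i _ xi]; apply: term_app_agree xi.
pose arg (B : atom) j :=
  if insub j is Some k then atom_args B k else term_app s (a i).
have /(congr1 (fun B => arg B i)) := E.
by rewrite /arg /= valK !ffunE.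
Qed.

(* Terms, atoms, goals, clauses and equations all have variables and carry
   the homomorphic action of substitutions. *)
Class expr (X : Type) := Expr {
  vars : X -> {fset V};
  app : subst -> X -> X;
  app_agree : forall s s' (e : X),
    app s e = app s' e -> {in vars e, s =1 s'} }.

#[global] Instance term_expr : expr term := Expr term_app_agree.
#[global] Instance atom_expr : expr atom := Expr atom_app_agree.

Section ExprConstructors.
Variables (X Y : Type) (EX : expr X) (EY : expr Y).

Lemma seq_app_agree (s s' : subst) (e : seq X) :
  map (app s) e = map (app s') e ->
  {in \bigcup_(a <- e) vars a, s =1 s'}.
Proof.
elim: e => [_ x|a e IH] /=; first by rewrite big_nil inE.
case=> Ea Ee x; rewrite big_cons inE => /orP[|]; last exact: IH.
exact: app_agree.
Qed.

Lemma prod_app_agree (s s' : subst) (e : X * Y) :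
  (app s e.1, app s e.2) = (app s' e.1, app s' e.2) ->
  {in vars e.1 `|` vars e.2, s =1 s'}.
Proof.
by case=> E1 E2 x; rewrite inE => /orP[|]; apply: app_agree.
Qed.

#[global] Instance seq_expr : expr (seq X) := Expr seq_app_agree.
#[global] Instance prod_expr : expr (X * Y) := Expr prod_app_agree.

End ExprConstructors.

Definition subst_vars (s : subst) : {fset V} :=
  finsupp s `|` \bigcup_(x <- finsupp s) vars (s x).

Definition subst_id : subst := [fsfun for Var].

Definition comp (s' s : subst) : subst :=
  [fsfun x in finsupp s `|` finsupp s' => app s' (s x) | Var x].

Lemma compE s' s x : comp s' s x = app s' (s x).
Proof.
rewrite fsfunE inE; case: ifPn => // /norP[xs xs'].
by rewrite (fsfun_dflt xs) /= (fsfun_dflt xs').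
Qed.

(* Substitutions mapping variables to variables, as maps on variables. *)
Definition varmap := {fsfun V -> V for id}.

Definition varmap_subst (a : varmap) : subst :=
  [fsfun x in finsupp a => Var (a x) | Var x].
Coercion varmap_subst : varmap >-> subst.

Lemma varmap_substE (a : varmap) x : varmap_subst a x = Var (a x).
Proof. by rewrite fsfunE; case: finsuppP. Qed.

Definition renaming (r : varmap) := bijective r.

(* The substitution { a x / a (s x) : x in Dom s }; it is only meaningful when
   a is injective on the variables of s. *)
Definition subst_variant (a : varmap) (s : subst) : subst :=
  [fsfun y in [fset a x | x in finsupp s] =>
     if [pick x : finsupp s | a (val x) == y] is Some x
     then app a (s (val x)) else Var y | Var y].

Lemma subst_variantE (a : varmap) (s : subst) (y : V) :
  {in finsupp s &, injective a} ->
  (forall x, x \in finsupp s -> subst_variant a s (a x) = app a (s x)) /\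
  ((forall x, x \in finsupp s -> a x <> y) -> subst_variant a s y = Var y).
Proof.
move=> inj; split=> [x xs|ny]; rewrite fsfunE.
  rewrite in_imfset //; case: pickP => [z /eqP E|/(_ [` xs])] /=.
    by rewrite (inj _ _ (valP z) xs E).
  by rewrite eqxx.
by case: ifPn => // /imfsetP[x /= xs E]; case: (ny x xs).
Qed.

Record prenaming := Prenaming {
  vmap :> varmap;
  core : {fset V};
  core_dom : finsupp vmap `<=` core;
  core_inj : {in core &, injective vmap} }.

Definition range (a : prenaming) : {fset V} := [fset vmap a x | x in core a].
Definition noninj (a : prenaming) : {fset V} := range a `\` core a.
Definition indom (a : prenaming) : pred V := [pred x | x \notin noninj a].

(* To be applied to the variables of an expression or of a substitution. *)
Definition safe (a : prenaming) (W : {fset V}) := {subset W <= indom a}.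

Definition variant (X : Type) (EX : expr X) (e e' : X) :=
  exists2 a : prenaming, safe a (vars e') & e = app a e'.

Definition summable (a b : prenaming) :=
  [disjoint core a & core b]%fset && [disjoint range a & range b]%fset.

Definition sum_map (a b : prenaming) : varmap :=
  [fsfun x in core a `|` core b => if x \in core a then vmap a x else vmap b x | x].

Lemma sum_map_dom a b : finsupp (sum_map a b) `<=` core a `|` core b.
Proof.
apply/fsubsetP => x; rewrite mem_finsupp fsfunE.
by case: ifP => //; rewrite eqxx.
Qed.

Lemma sum_map_inj a b : summable a b ->
  {in core a `|` core b &, injective (sum_map a b)}.
Proof.
case/andP=> _ /fdisjointP rD x y xC yC; rewrite !fsfunE xC yC.
have inr (c : prenaming) z : z \in core c -> vmap c z \in range c.
  by move=> zc; apply: in_imfset.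
move: xC yC; rewrite !in_fsetU.
case xa: (x \in core a); case ya: (y \in core a) => //= xb yb E.
- exact: (@core_inj a).
- by have := rD _ (inr a x xa); rewrite E inr.
- by have := rD _ (inr a y ya); rewrite -E inr.
- exact: (@core_inj b).
Qed.

(* The sum is only defined on summable prenamings; otherwise the value
   returned here is meaningless. *)
Definition psum (a b : prenaming) : prenaming :=
  match @idP (summable a b) with
  | ReflectT h => Prenaming (sum_map_dom a b) (sum_map_inj h)
  | ReflectF _ => a
  end.

Lemma psumE a b : summable a b ->
  core (psum a b) = core a `|` core b /\
  forall x, vmap (psum a b) x =
    if x \in core a then vmap a x
    else if x \in core b then vmap b x else x.
Proof.
rewrite /psum => h; destruct (@idP (summable a b)) => //; split=> // x /=.
by rewrite fsfunE inE; case: (x \in core a).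
Qed.

Definition is_pren (X : Type) (EX : expr X) (e e' : X) (a : prenaming) :=
  core a = vars e /\ app a e = e'.

Lemma is_pren_uniq (X : Type) (EX : expr X) (e e' : X) a b :
  is_pren EX e e' a -> is_pren EX e e' b -> a = b.
Proof.
case: a b => [a A aA iA] [b B bB iB] [/= EA Ea] [/= EB Eb]; subst A B.
have ab : a = b.
  apply/fsfunP => x; have [xe|xe] := boolP (x \in vars e).
    have := app_agree (etrans Ea (esym Eb)) xe.
    by rewrite !varmap_substE => -[].
  by rewrite !fsfun_dflt //; apply: contra xe; apply/fsubsetP.
by subst b; congr Prenaming; apply: Prop_irrelevance.
Qed.

Lemma prenaming_id_dom : finsupp ([fsfun for id] : varmap) `<=` fset0.
Proof. by apply/fsubsetP => x; rewrite mem_finsupp fsfun0E eqxx. Qed.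

Lemma prenaming_id_inj :
  {in (fset0 : {fset V}) &, injective ([fsfun for id] : varmap)}.
Proof. by move=> x; rewrite inE. Qed.

Definition prenaming_id := Prenaming prenaming_id_dom prenaming_id_inj.

(* Meaningful only if a prenaming as required exists; it is then unique by
   is_pren_uniq. *)
Definition pren (X : Type) (EX : expr X) (e e' : X) : prenaming :=
  match pselect (exists a, is_pren EX e e' a) with
  | left h => sval (cid h)
  | right _ => prenaming_id
  end.

Lemma prenP (X : Type) (EX : expr X) (e e' : X) a :
  is_pren EX e e' a -> pren EX e e' = a.
Proof.
move=> Ha; rewrite /pren; case: pselect => [h|[]]; last by exists a.
exact: (is_pren_uniq (svalP (cid h)) Ha).
Qed.

Definition unifier (s : subst) (E : equation) := app s E.1 = app s E.2.
Definition unifiable (E : equation) := exists s, unifier s E.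
Definition is_mgu (s : subst) (E : equation) :=
  unifier s E /\ forall s', unifier s' E -> exists d, s' = comp d s.

(* None stands for failure. *)
Definition algorithm := equation -> option subst.

Definition unification_algorithm (U : algorithm) :=
  (forall E s, U E = Some s -> is_mgu s E) /\
  (forall E, unifiable E -> exists s, U E = Some s).

Definition renaming_compatible (U : algorithm) :=
  forall (r : varmap) (E : equation), renaming r -> unifiable E ->
    U (app r E) = omap (subst_variant r) (U E).

Definition relevant (U : algorithm) :=
  forall E s, U E = Some s -> subst_vars s `<=` vars E.1 `|` vars E.2.

(* The i-th step, for 0 < i <= len, selects the atom at position sel i of
   goals i.-1 and uses the input clause inputs i and the mgu mgus i to produce
   goals i; goals 0 is the initial goal. The values of inputs, mgus and sel
   at 0, and of all the functions beyond len, are irrelevant. *)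
Record derivation := Derivation {
  len : nat;
  goals : nat -> goal;
  inputs : nat -> clause;
  mgus : nat -> subst;
  sel : nat -> nat }.

Definition sld_step (U : algorithm) (G : goal) (p : nat) (K : clause)
    (s : subst) (H : goal) :=
  exists M A N, [/\ G = M ++ A :: N, size M = p, U (A, K.1) = Some s
                  & H = app s (M ++ K.2 ++ N)].

(* All the variables occurring before step i. *)
Definition vars_before (D : derivation) (i : nat) : {fset V} :=
  \bigcup_(j <- index_iota 0 i) vars (goals D j) `|`
  \bigcup_(j <- index_iota 1 i) (vars (inputs D j) `|` subst_vars (mgus D j)).

Definition sld_derivation (U : algorithm) (P : clause -> Prop)
    (D : derivation) :=
  forall i, 0 < i <= len D ->
    [/\ exists2 C, P C & variant _ (inputs D i) C,
        [disjoint vars (inputs D i) & vars_before D i]%fset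
      & sld_step U (goals D i.-1) (sel D i) (inputs D i) (mgus D i)
                 (goals D i)].

Definition similar (D D' : derivation) :=
  [/\ len D = len D', variant _ (goals D 0) (goals D' 0)
    & forall i, 0 < i <= len D ->
        sel D i = sel D' i /\ variant _ (inputs D i) (inputs D' i)].

Fixpoint partial_answer (D : derivation) (i : nat) : subst :=
  if i is j.+1 then comp (mgus D i) (partial_answer D j) else subst_id.

Fixpoint psums (a : prenaming) (l : nat -> prenaming) (i : nat) : prenaming :=
  if i is j.+1 then psum (psums a l j) (l i) else a.

End Syntax.

Arguments expr V S X : clear implicits.
Arguments variant {V S X EX}.
Arguments is_pren {V S X EX}.
Arguments pren {V S X EX}.

(* Main.v *)
Require Import Defs.
From mathcomp Require Import all_boot finmap.

(* A prenaming is injective on its finite core C, so |C \ R| = |R \ C| for its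
   range R, and any bijection from R \ C onto C \ R completes it to a renaming.
   Since mgus are relevant, every variable produced up to step i lies in the core
   of beta_i, so beta_i can be replaced there by a renaming rho.  For a renaming,
   the substitution variant is conjugation, rho o sigma o rho^-1; conjugation
   commutes with composition and with the action on expressions, so each SLD step
   is transported by rho thanks to the renaming compatibility of U. *)

Local Open Scope fset_scope.
Set Implicit Arguments.
Unset Strict Implicit.
Unset Printing Implicit Defensive.

(** * Laws of the substitution action, and substitution variants as conjugation *)

Section Expressions.
Variables (V : countType) (S : signature).
Implicit Types (s : subst V S).

(** [app_ext] is the converse of the field [app_agree] of [expr]. As a class, these laws pass by
    instance resolution from terms up to goals and clauses. *)
Class lawful_expr (X : Type) (EX : expr V S X) := LawfulExpr {
  app_ext : forall s s' (e : X), {in vars e, s =1 s'} -> app s e = app s' e;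
  app_comp : forall s s' (e : X), app s (app s' e) = app (Defs.comp s s') e;
  app_id : forall e : X, app (subst_id V S) e = e;
  vars_appP : forall s (e : X) y,
    reflect (exists2 x, x \in vars e & y \in vars (s x)) (y \in vars (app s e)) }.

#[global] Instance term_lawful : lawful_expr (term_expr V S).
Proof.
split.
- move=> s s'; elim/term_induction => [x|f a IH] /= ss.
    by apply: ss; rewrite inE.
  apply: (congr1 (@App V S f)); apply/ffunP => i; rewrite !ffunE; apply: IH => x xi.
  by apply: ss; apply/bigfcupP; exists i; rewrite ?mem_index_enum.
- move=> s s'; elim/term_induction => [x|f a IH] /=; first by rewrite Defs.compE.
  by apply: (congr1 (@App V S f)); apply/ffunP => i; rewrite !ffunE; apply: IH.
- elim/term_induction => [x|f a IH] /=; first by rewrite fsfun0E.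
  by apply: (congr1 (@App V S f)); apply/ffunP => i; rewrite ffunE; apply: IH.
- move=> s e y; apply: (iffP idP); elim/term_induction: e => [x|f a IH] /=.
  + by move=> ys; exists x; rewrite ?inE.
  + case/bigfcupP=> i _; rewrite ffunE => /IH[x xi yx].
    by exists x => //; apply/bigfcupP; exists i; rewrite ?mem_index_enum.
  + by case=> z; rewrite inE => /eqP->.
  + case=> x /bigfcupP[i _ xi] yx; apply/bigfcupP; exists i; rewrite ?mem_index_enum //.
    by rewrite ffunE; apply: IH; exists x.
Qed.

#[global] Instance atom_lawful : lawful_expr (atom_expr V S).
Proof.
split.
- move=> s s' [p a] /= ss; apply: (congr1 (@Atom V S p)); apply/ffunP => i; rewrite !ffunE.
  by apply: app_ext => x xi; apply: ss; apply/bigfcupP; exists i; rewrite ?mem_index_enum.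
- move=> s s' [p a] /=; apply: (congr1 (@Atom V S p)); apply/ffunP => i; rewrite !ffunE.
  exact: app_comp.
- move=> [p a] /=; apply: (congr1 (@Atom V S p)); apply/ffunP => i; rewrite ffunE; exact: app_id.
- move=> s [p a] y /=; apply: (iffP (bigfcupP _ _ _ _)).
    case=> i _ /=; rewrite ffunE => /(@vars_appP _ _ term_lawful)[x xi yx].
    by exists x => //; apply/bigfcupP; exists i; rewrite ?mem_index_enum.
  case=> x /bigfcupP[i _ xi] yx; exists i; rewrite ?mem_index_enum //= ffunE.
  by apply/(@vars_appP _ _ term_lawful); exists x.
Qed.

#[global] Instance seq_lawful (X : Type) (EX : expr V S X) :
  lawful_expr EX -> lawful_expr (seq_expr EX).
Proof.
move=> lX; split.
- move=> s s'; elim=> //= a e IH ss; congr cons; [apply: app_ext|apply: IH];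
    by move=> x xe; apply: ss; rewrite big_cons inE xe ?orbT.
- by move=> s s'; elim=> //= a e ->; rewrite app_comp.
- by elim=> //= a e ->; rewrite app_id.
- move=> s e y; apply: (iffP idP); elim: e => [|a e IH] /=.
  + by rewrite big_nil.
  + rewrite !big_cons inE => /orP[/vars_appP|/IH] [x xe yx];
      by exists x => //; rewrite inE xe ?orbT.
  + by case=> x; rewrite big_nil.
  + case=> x; rewrite !big_cons !inE => /orP[] xe yx; apply/orP;
      [left; apply/vars_appP|right; apply: IH]; by exists x.
Qed.

#[global] Instance prod_lawful (X Y : Type) (EX : expr V S X) (EY : expr V S Y) :
  lawful_expr EX -> lawful_expr EY -> lawful_expr (prod_expr EX EY).
Proof.
move=> lX lY; split.
- move=> s s' [a b] /= ss; congr pair; apply: app_ext => x xe;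
    by apply: ss; rewrite inE xe ?orbT.
- by move=> s s' [a b] /=; rewrite !app_comp.
- by move=> [a b] /=; rewrite !app_id.
- move=> s [a b] y /=; rewrite inE; apply: (iffP orP).
    by case=> /vars_appP[x xe yx]; exists x => //; rewrite inE xe ?orbT.
  case=> x; rewrite inE => /orP[] xe yx; [left|right];
    by apply/vars_appP; exists x.
Qed.

Lemma vars_subst s x : vars (s x) `<=` x |` subst_vars s.
Proof.
apply/fsubsetP => y; have [xs yx|xs] := boolP (x \in finsupp s).
  by rewrite !inE; apply/or3P/Or33/bigfcupP; exists x; rewrite ?xs.
by rewrite fsfun_dflt //= !inE => ->.
Qed.

Lemma vars_app_sub X (EX : expr V S X) (lX : lawful_expr EX) s (e : X) :
  vars (app s e) `<=` vars e `|` subst_vars s.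
Proof.
apply/fsubsetP => y /vars_appP[x xe /(fsubsetP (vars_subst s x))].
by rewrite !inE => /orP[/eqP->|->]; rewrite ?xe ?orbT.
Qed.

Lemma subst_vars_comp s' s :
  subst_vars (Defs.comp s' s) `<=` subst_vars s `|` subst_vars s'.
Proof.
have dom x : x \in finsupp (Defs.comp s' s) -> x \in subst_vars s `|` subst_vars s'.
  rewrite mem_finsupp Defs.compE => xc; rewrite !inE -!orbA.
  apply: contraR xc => /norP[xs /norP[_ /norP[xs' _]]].
  by rewrite (fsfun_dflt xs) /= (fsfun_dflt xs').
apply/fsubsetP => y; rewrite {1}/subst_vars in_fsetU => /orP[/dom//|].
case/bigfcupP=> x /andP[/dom xss' _]; rewrite Defs.compE.
move/(fsubsetP (vars_app_sub _ _ _)); rewrite in_fsetU => /orP[|ys'].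
  move/(fsubsetP (vars_subst _ _)); rewrite in_fset1U => /orP[/eqP-> //|ys].
  by rewrite in_fsetU ys.
by rewrite in_fsetU ys' orbT.
Qed.

Lemma subst_vars_id : subst_vars (subst_id V S) = fset0.
Proof. by rewrite /subst_vars finsupp0 fset0U big_nil. Qed.

Lemma subst_variant_id (a : varmap V) : subst_variant a (subst_id V S) = subst_id V S.
Proof.
apply/fsfunP => y; rewrite [LHS]fsfunE fsfun0E; case: ifP => //.
by case/imfsetP => x /=; rewrite finsupp0.
Qed.

(** No injectivity is required: both [pick] predicates coincide on [finsupp s], so even an ambiguous
    preimage is chosen alike. This allows a prenaming to be exchanged for a renaming agreeing with
    it on the variables of [s]. *)
Lemma subst_variant_ext (a b : varmap V) s :
  {in subst_vars s, a =1 b} -> subst_variant a s = subst_variant b s.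
Proof.
move=> ab; have abs x : x \in finsupp s -> a x = b x.
  by move=> xs; apply: ab; rewrite inE xs.
have im : [fset a x | x in finsupp s] = [fset b x | x in finsupp s].
  by apply: eq_in_imfset.
apply/fsfunP => y; rewrite !fsfunE im; case: ifP => // _.
have -> : [pick x : finsupp s | a (val x) == y] =
          [pick x : finsupp s | b (val x) == y].
  by apply: eq_pick => x; rewrite abs ?(valP x).
case: pickP => // x _; apply: app_ext => z zx; rewrite !varmap_substE ab //.
by rewrite inE; apply/orP; right; apply/bigfcupP; exists (val x) => //; rewrite (valP x).
Qed.

(** The conjugation law, stated at [r x] to avoid an inverse of [r]. If [x] is outside the domain of
    [s], injectivity keeps [r x] out of the image of that domain, and both sides are [Var (r x)]. *)
Lemma subst_variant_app (r : varmap V) s x :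
  injective r -> subst_variant r s (r x) = app (varmap_subst S r) (s x).
Proof.
move=> rI; have [//|E1 E2] := @subst_variantE _ _ r s (r x); first by move=> ? ? _ _ /rI.
have [xs|xs] := boolP (x \in finsupp s); first exact: E1.
rewrite (fsfun_dflt xs) /= varmap_substE; apply: E2 => z zs /rI zx.
by rewrite -zx zs in xs.
Qed.

Lemma app_subst_variant X (EX : expr V S X) (lX : lawful_expr EX)
    (r : varmap V) s (e : X) : injective r ->
  app (subst_variant r s) (app r e) = app r (app s e).
Proof.
move=> rI; rewrite !app_comp; apply: app_ext => x _.
by rewrite !Defs.compE varmap_substE /= subst_variant_app.
Qed.

Lemma comp_subst_variant (r : varmap V) s' s : renaming r ->
  Defs.comp (subst_variant r s') (subst_variant r s) = subst_variant r (Defs.comp s' s).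
Proof.
(* Surjectivity matters here: every [y] is written as [r (q y)], where the conjugation law
   applies. *)
move=> rB; have rI := bij_inj rB; case: rB => q _ rK; apply/fsfunP => y.
by rewrite -(rK y) Defs.compE !subst_variant_app // Defs.compE app_subst_variant.
Qed.

End Expressions.

(** * Inverting prenamings and completing them to renamings *)

Section Prenamings.
Variables (V : countType) (S : signature).

Lemma vmap_id (a : prenaming V) x : x \notin core a -> vmap a x = x.
Proof. by move=> xa; apply/fsfun_dflt/(contra _ xa)/fsubsetP/core_dom. Qed.

Lemma prenaming_inv (a : V -> V) (W : {fset V}) : {in W &, injective a} ->
  exists2 b : prenaming V, core b = [fset a x | x in W]
                         & {in W, cancel a (vmap b)}.
Proof.
move=> aI; set C := [fset a x | x in W].
(* The inverse reads [W] at the position of [y] in the list of images; the default [y] of [nth] is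
   never reached on [C]. *)
pose b : varmap V := [fsfun y in C => nth y W (index y [seq a x | x <- W]) | y].
have bK : {in W, cancel a b}.
  by move=> x xW; rewrite fsfunE in_imfset // nth_index_map.
have bC : finsupp b `<=` C.
  by apply/fsubsetP => y; rewrite mem_finsupp fsfunE; case: ifP; rewrite ?eqxx.
have bI : {in C &, injective b}.
  by move=> _ _ /imfsetP[x /= xW ->] /imfsetP[y /= yW ->]; rewrite !bK // => ->.
by exists (Prenaming bC bI).
Qed.

(** Elements at equal positions in the enumerations of [A] and [B] are paired. *)
Lemma prenaming_card_eq (A B : {fset V}) : #|` A| = #|` B| ->
  exists2 g : prenaming V, core g = A & range g = B.
Proof.
move=> AB; pose f x := nth x B (index x A).
have nthB x : x \in A -> f x \in B.
  by move=> xA; rewrite mem_nth // -AB index_mem.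
have fI : {in A &, injective f}.
  move=> x y xA yA; rewrite /f (set_nth_default y) -?AB ?index_mem //.
  by move/eqP; rewrite nth_uniq -?AB ?index_mem // => /eqP /index_inj ->.
have imf : [fset f x | x in A] = B.
  apply/eqP; rewrite eqEfcard; apply/andP; split.
    by apply/fsubsetP => _ /imfsetP[x /= /nthB xA ->].
  by rewrite card_in_imfset //= AB.
(* [prenaming_inv] only delivers inverses, so [f] is turned into a prenaming by inverting it
   twice. *)
have [b bC bK] := prenaming_inv fI; rewrite imf in bC.
have [g gC gK] := prenaming_inv (@core_inj _ b).
have rb : [fset vmap b x | x in core b] = A.
  apply/fsetP => x; apply/imfsetP/idP => [[y /=]|xA].
    by rewrite bC -imf => /imfsetP[z /= zA ->] ->; rewrite bK.
  by exists (f x); rewrite ?bK //= bC nthB.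
exists g; first by rewrite gC.
apply/fsetP => y; apply/imfsetP/idP => [[x /=]|yB].
  by rewrite gC => /imfsetP[z /= zB ->] ->; rewrite gK // -bC.
by exists (vmap b y); rewrite ?gK /= ?gC ?bC //; apply: in_imfset; rewrite /= ?bC.
Qed.

Lemma range_psum (a b : prenaming V) : summable a b ->
  range (psum a b) = range a `|` range b.
Proof.
move=> ab; have [C E] := psumE ab; have /andP[/fdisjointP dis _] := ab.
apply/fsetP => y; rewrite inE; apply/imfsetP/orP => [[x /=]|].
  rewrite C E inE; case: ifP => /= [xa _ ->|_ xb ->]; first by left; apply: in_imfset.
  by rewrite xb; right; apply: in_imfset.
case=> /imfsetP[x /= xa ->]; exists x; rewrite /= ?C ?E ?inE ?xa ?orbT //.
by case: ifP => // /dis; rewrite xa.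
Qed.

(** Such a prenaming permutes its core and fixes all other variables; its inverse on the core has
    the same core, hence is a global inverse. *)
Lemma renaming_core_range (a : prenaming V) : range a = core a -> renaming (vmap a).
Proof.
move=> ra; have [b bC bK] := prenaming_inv (@core_inj _ a).
have {}bC : core b = core a by rewrite bC -[in RHS]ra.
exists (vmap b) => x; have [xa|xa] := boolP (x \in core a).
- exact: bK.
- by rewrite (vmap_id xa) vmap_id ?bC.
- by move: xa; rewrite -{1}ra => /imfsetP[y /= ya ->]; rewrite bK.
- by rewrite [vmap b x]vmap_id ?bC // vmap_id.
Qed.

Lemma prenaming_renaming (a : prenaming V) :
  exists2 r : varmap V, renaming r & {in core a, r =1 vmap a}.
Proof.
have cC : #|` range a `\` core a| = #|` core a `\` range a|.
  have : #|` range a| = #|` core a| by rewrite card_in_imfset //; apply: core_inj.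
  rewrite -(cardfsID (core a) (range a)) -(cardfsID (range a) (core a)).
  by rewrite fsetIC => /addnI.
have [g gC gR] := prenaming_card_eq cC.
have ag : summable a g.
  by rewrite /summable gC gR; apply/andP; split; apply/fdisjointP => x xa; rewrite inE xa.
(* Core and range of [psum a g] both equal the union of [core a] and [range a]. *)
have [C E] := psumE ag; exists (vmap (psum a g)); last by move=> x xa; rewrite E xa.
apply: renaming_core_range; rewrite range_psum // C gC gR.
by apply/fsetP => x; rewrite !inE; case: (x \in core a); case: (x \in range a).
Qed.

(** The only possible collision is between a core variable and a fixed variable outside the core;
    the latter would then lie in [noninj a], which safety excludes. *)
Lemma safe_inj (a : prenaming V) (W : {fset V}) :
  safe a W -> {in W &, injective (vmap a)}.
Proof.
move=> aW; have sep x y : x \in core a -> y \in W -> y \notin core a ->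
    vmap a x <> y.
  move=> xa yW ya xy; have := aW _ yW; rewrite !inE ya -xy.
  by rewrite in_imfset.
move=> x y xW yW; have [xa|xa] := boolP (x \in core a);
  have [ya|ya] := boolP (y \in core a).
- exact: core_inj.
- by rewrite (vmap_id ya) => /sep; case.
- by rewrite (vmap_id xa) => /esym /sep; case.
- by rewrite !vmap_id.
Qed.

Lemma safe_core (a : prenaming V) (W : {fset V}) : W `<=` core a -> safe a W.
Proof. by move=> /fsubsetP Wa x /Wa xa; rewrite !inE xa. Qed.

Lemma vars_app_varmap X (EX : expr V S X) (lX : lawful_expr EX)
    (a : varmap V) (e : X) : vars (app a e) = [fset a x | x in vars e].
Proof.
apply/fsetP => y; apply/vars_appP/imfsetP => -[x xe].
  by rewrite varmap_substE inE => /eqP; exists x.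
by move=> ->; exists x; rewrite // varmap_substE inE.
Qed.

Lemma is_pren_range X (EX : expr V S X) (lX : lawful_expr EX) (e e' : X) a :
  is_pren e e' a -> range a = vars e'.
Proof. by case=> aC <-; rewrite vars_app_varmap /range aC. Qed.

(** The witness of [variant e e'] maps [e'] to [e], whereas [pren e e'] goes from [e] to [e']: it is
    the inverse of that witness on [vars e']. *)
Lemma variant_pren X (EX : expr V S X) (lX : lawful_expr EX) (e e' : X) :
  variant e e' -> is_pren e e' (pren e e').
Proof.
case=> a /safe_inj/prenaming_inv[b bC bK] eE.
suff ab : @is_pren _ _ _ EX e e' b by rewrite (prenP ab).
split; first by rewrite bC eE vars_app_varmap.
rewrite eE app_comp -[RHS]app_id; apply: app_ext => x xe.
by rewrite Defs.compE !varmap_substE /= varmap_substE bK // fsfun0E.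
Qed.

End Prenamings.

(** * Transport of SLD steps and induction along the derivations *)

Section Derivations.
Variables (V : countType) (S : signature) (U : algorithm V S).
Hypothesis U_unif : unification_algorithm U.
Hypothesis U_compat : renaming_compatible U.
Hypothesis U_relevant : relevant U.

(** Relevance of the mgus enters here. *)
Lemma sld_step_vars G p K s H : sld_step U G p K s H ->
  subst_vars s `<=` vars G `|` vars K /\ vars H `<=` vars G `|` vars K.
Proof.
case=> M [A [N [-> _ /U_relevant sAK ->]]].
have sGK : subst_vars s `<=` vars (M ++ A :: N) `|` vars K.
  apply: fsubset_trans sAK _; apply/fsubsetP => x.
  by rewrite /= big_cat big_cons /= !in_fsetU => /orP[] ->; rewrite ?orbT.
split=> //; apply: fsubset_trans (vars_app_sub _ _ _) _.
rewrite fsubUset sGK andbT; apply/fsubsetP => x.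
rewrite /= !big_cat big_cons /= !in_fsetU.
by case/or3P => ->; rewrite ?orbT.
Qed.

(** The equation solved in the second step is the renamed first one, so renaming compatibility
    determines its mgu; conjugation then transports the resolvent. *)
Lemma sld_step_renaming (r : varmap V) G p K s H s' H' : renaming r ->
  sld_step U G p K s H -> sld_step U (app r G) p (app r K) s' H' ->
  s' = subst_variant r s /\ H' = app r H.
Proof.
move=> rR [M [A [N [-> <- UE ->]]]] [M' [A' [N' [GE sM UE' ->]]]].
have rM : size [seq app r B | B <- M] = size M by rewrite size_map.
move: GE; rewrite /= map_cat /= => GE.
(* Both prefixes have length [p], so [take] and [drop] identify the two decompositions of the
   goal. *)
have := congr1 (take (size M)) GE; rewrite !take_size_cat // => ME.
have := congr1 (drop (size M)) GE; rewrite !drop_size_cat //.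
case=> AE NE; subst M' A' N'.
have uE : unifiable (A, K.1) by exists s; have [+ _] := U_unif => /(_ _ _ UE) [].
have := U_compat rR uE; rewrite UE /= UE' => -[->]; split=> //.
have := app_subst_variant (seq_lawful (atom_lawful V S)) s (M ++ K.2 ++ N) (bij_inj rR).
by rewrite /= !map_cat.
Qed.

Lemma vars_before_goal (D : derivation V S) i j : j < i ->
  vars (goals D j) `<=` vars_before D i.
Proof.
move=> ji; apply: fsubset_trans (fsubsetUl _ _).
by apply/fsubsetP => x xj; apply/bigfcupP; exists j; rewrite ?mem_index_iota ?andbT.
Qed.

Lemma vars_before_input (D : derivation V S) i j : 0 < j < i ->
  vars (inputs D j) `<=` vars_before D i.
Proof.
move=> ji; apply: fsubset_trans (fsubsetUr _ _).
apply: fsubset_trans (fsubsetUl _ (subst_vars (mgus D j))) _.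
by apply/fsubsetP => x xj; apply/bigfcupP; exists j; rewrite ?mem_index_iota ?andbT.
Qed.

Lemma vars_beforeS (D : derivation V S) i : vars_before D i `<=` vars_before D i.+1.
Proof.
apply/fsubsetP => x; rewrite !in_fsetU => /orP[] /bigfcupP[j].
  rewrite andbT mem_index_iota => /andP[_ ji] xj; apply/orP; left.
  by apply/bigfcupP; exists j; rewrite // andbT mem_index_iota ltnS (ltnW ji).
rewrite andbT mem_index_iota => /andP[lj ji] xj; apply/orP; right.
by apply/bigfcupP; exists j; rewrite // mem_index_iota lj ltnS (ltnW ji).
Qed.

Variables (P : clause V S -> Prop) (D D' : derivation V S).
Hypothesis D_sld : sld_derivation U P D.
Hypothesis D'_sld : sld_derivation U P D'.
Hypothesis D_sim : similar D D'.

Let lambda i := pren (inputs D i) (inputs D' i).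
Let beta := psums (pren (goals D 0) (goals D' 0)) lambda.

(** The induction invariant. The bounds by [vars_before] serve summability with the next clause
    prenaming; the inclusions in the core let [beta i] act as a renaming. Mgus are left out, since
    [mgus D 0] has no meaning. *)
Record variant_upto (i : nat) : Prop := VariantUpto {
  upto_core : core (beta i) `<=` vars_before D i.+1;
  upto_range : range (beta i) `<=` vars_before D' i.+1;
  upto_goal : vars (goals D i) `<=` core (beta i);
  upto_answer : subst_vars (partial_answer D i) `<=` core (beta i);
  upto_goalE : goals D' i = app (beta i) (goals D i);
  upto_answerE :
    partial_answer D' i = subst_variant (beta i) (partial_answer D i) }.

Lemma initial_pren : is_pren (goals D 0) (goals D' 0) (pren (goals D 0) (goals D' 0)).
Proof. by case: D_sim => _ ? _; apply: variant_pren. Qed.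

Lemma variant_upto0 : variant_upto 0.
Proof.
have [C E] := initial_pren; split=> /=.
- by rewrite C vars_before_goal.
- by rewrite (is_pren_range _ initial_pren) vars_before_goal.
- by rewrite C.
- by rewrite subst_vars_id.
- exact: esym E.
- by rewrite subst_variant_id.
Qed.

Lemma variant_uptoS i : i < len D -> variant_upto i ->
  [/\ variant_upto i.+1, is_pren (inputs D i.+1) (inputs D' i.+1) (lambda i.+1),
      summable (beta i) (lambda i.+1),
      subst_vars (mgus D i.+1) `<=` core (beta i.+1)
    & mgus D' i.+1 = subst_variant (beta i.+1) (mgus D i.+1)].
Proof.
move=> il [Ci Ri Gi Ai GEi AEi]; case: D_sim => lenE _ sim.
have [_ dK step] := D_sld (i := i.+1) il.
have [_ dK' step'] := D'_sld (i := i.+1) (eq_ind _ (fun n => i < n) il _ lenE).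
have [selE Kvar] := sim i.+1 il.
have lP : is_pren (inputs D i.+1) (inputs D' i.+1) (lambda i.+1) by apply: variant_pren.
have [lC lE] := lP; have lR := is_pren_range _ lP.
(* Standardization apart in [D] separates the cores, and in [D'] the ranges. *)
have sm : summable (beta i) (lambda i.+1).
  apply/andP; split; rewrite fdisjoint_sym ?lC ?lR.
    exact: fdisjointWr dK.
  exact: fdisjointWr dK'.
have [bC bE] := psumE sm; rewrite -/(beta i.+1) in bC bE.
have bR : range (beta i.+1) = range (beta i) `|` range (lambda i.+1) := range_psum sm.
(* One renaming [r] completes [beta i.+1]; by [bi] and [bl] it also agrees with [beta i] and
   [lambda i.+1] on their cores, so it replaces all three. *)
have [r rR rb] := prenaming_renaming (beta i.+1).
have bi x : x \in core (beta i) -> r x = vmap (beta i) x.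
  by move=> xi; rewrite rb ?bC ?in_fsetU ?xi // bE xi.
have bl x : x \in core (lambda i.+1) -> r x = vmap (lambda i.+1) x.
  move=> xl; rewrite rb ?bC ?in_fsetU ?xl ?orbT // bE xl.
  by case: ifP => // xi; case/andP: sm => /fdisjointP/(_ _ xi); rewrite xl.
have ext X (EX : expr V S X) (lX : lawful_expr EX) (e : X) (a : prenaming V) :
    {in core a, r =1 vmap a} -> vars e `<=` core a -> app a e = app r e.
  by move=> ra /fsubsetP ea; apply: app_ext => x /ea xe; rewrite !varmap_substE ra.
have extS (s : subst V S) (a : prenaming V) :
    {in core a, r =1 vmap a} -> subst_vars s `<=` core a ->
    subst_variant a s = subst_variant r s.
  by move=> ra /fsubsetP ea; apply: subst_variant_ext => x /ea xe; rewrite ra.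
have GKC : vars (goals D i) `|` vars (inputs D i.+1) `<=` core (beta i.+1).
  by rewrite bC lC fsetSU.
have [mV gV] := sld_step_vars step.
have {}mV := fsubset_trans mV GKC; have {}gV := fsubset_trans gV GKC.
(* The step of [D'] becomes a step from the [r]-image of the goal with the [r]-image of the
   clause. *)
rewrite -selE /= GEi -lE !(ext _ _ _ _ _ bi, ext _ _ _ _ _ bl) ?lC // in step'.
have [mE gE] := sld_step_renaming rR step step'.
have aV : subst_vars (partial_answer D i.+1) `<=` core (beta i.+1).
  apply: fsubset_trans (subst_vars_comp _ _) _; rewrite fsubUset mV andbT.
  by apply: fsubset_trans Ai _; rewrite bC fsubsetUl.
split=> //; last by rewrite (extS _ _ rb).
split=> //.
- rewrite bC fsubUset (fsubset_trans Ci (vars_beforeS _ _)) lC.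
  by apply: vars_before_input; rewrite /= ltnSn.
- rewrite bR fsubUset (fsubset_trans Ri (vars_beforeS _ _)) lR.
  by apply: vars_before_input; rewrite /= ltnSn.
- by rewrite (ext _ _ _ _ _ rb).
(* The previous answer and the new mgu are both conjugated by the same [r], so their composition is
   too. *)
- by rewrite (extS _ _ rb) //= mE AEi (extS _ _ bi) // comp_subst_variant.
Qed.

Lemma variant_uptoP i : i <= len D -> variant_upto i.
Proof.
elim: i => [_|i IH il]; first exact: variant_upto0.
by have [] := variant_uptoS il (IH (ltnW il)).
Qed.

End Derivations.

Unset Implicit Arguments.

Theorem mainTheorem1 (V : countType)
    (V_infinite : forall W : {fset V}, exists x, x \notin W)
    (S : signature) (P : clause V S -> Prop) (U : algorithm V S)
    (U_unif : unification_algorithm U)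
    (U_compat : renaming_compatible U)
    (U_relevant : relevant U)
    (D D' : derivation V S)
    (D_sld : sld_derivation U P D)
    (D'_sld : sld_derivation U P D')
    (D_sim : similar D D') :
  let alpha := pren (goals D 0) (goals D' 0) in
  let lambda i := pren (inputs D i) (inputs D' i) in
  let beta := psums alpha lambda in
  is_pren (goals D 0) (goals D' 0) alpha /\
  forall i, 0 < i <= len D ->
    [/\ is_pren (inputs D i) (inputs D' i) (lambda i),
        summable (beta i.-1) (lambda i)
      & [/\ safe (beta i) (vars (goals D i)),
            safe (beta i) (subst_vars (mgus D i))
          & safe (beta i) (subst_vars (partial_answer D i))]] /\
    [/\ goals D' i = app (beta i) (goals D i),
        mgus D' i = subst_variant (beta i) (mgus D i)
      & partial_answer D' i = subst_variant (beta i) (partial_answer D i)].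
Proof.
move=> alpha lambda beta; split=> [|[//|i] /andP[_ il]]; first exact: initial_pren.
(* The positive index is now [i.+1]: the invariant at [i] is fed to the induction step, which also
   yields the claims on the clause and the mgu. *)
have upto := variant_uptoP U_unif U_compat U_relevant D_sld D'_sld D_sim (ltnW il).
have [[_ _ gV aV gE aE] lP sm mV mE] :=
  variant_uptoS U_unif U_compat U_relevant D_sld D'_sld D_sim il upto.
by split; split=> //; split; apply: safe_core.
Qed.
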